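(* For every constant $\delta > 0$, a uniformly random boolean function $f : \{-1,1\}^n \to \{-1,1\}$ satisfies \[ \sum_{S \subseteq [n]} \widehat{f}(S)^2 \log_2 \frac{1}{\widehat{f}(S)^2} \;\leq\; (2+\delta) \sum_{S \subseteq [n]} \widehat{f}(S)^2 |S| \] with high probability, i.e. with probability tending to $1$ as $n \to \infty$.
   Context: A uniformly random boolean function $f:\{-1,1\}^n\to\{-1,1\}$ is obtained by choosing the values $f(x)$, $x \in \{-1,1\}^n$, independently and uniformly from $\{-1,1\}$; equivalently each of the $2^{2^n}$ functions is chosen with probability $2^{-2^n}$. For $S \subseteq [n]=\{1,\dots,n\}$, let $\chi_S(x)=\prod_{i\in S} x_i$ and let $\widehat{f}(S) = 2^{-n}\sum_{x\in\{-1,1\}^n} f(x)\chi_S(x)$ be the Fourier coefficient of $f$, so that $f=\sum_S \widehat{f}(S)\chi_S$. Terms with $\widehat{f}(S)=0$ in the sum $\sum_S \widehat{f}(S)^2\log_2(1/\widehat{f}(S)^2)$ (the Fourier entropy of $f$) are taken to be $0$. The quantity $\sum_S \widehat{f}(S)^2|S|$ is the total influence of $f$. *)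

(* Defs.v *)
From HB Require Import structures.
From mathcomp Require Import all_boot all_order all_algebra.
From mathcomp Require Import all_classical all_reals all_analysis.

Set Implicit Arguments.
Unset Strict Implicit.
Unset Printing Implicit Defensive.

Import Order.TTheory GRing.Theory Num.Theory.
Import numFieldNormedType.Exports.

Local Open Scope ring_scope.

(* The two-point set {-1,1} is encoded by [bool], where b stands for the
   number (-1)^b: [false] is 1 and [true] is -1. *)
Definition pm1 (R : realType) (b : bool) : R := (-1) ^+ b.

Definition cube (n : nat) : finType := {ffun 'I_n -> bool}.

Definition boolean_function (n : nat) : finType := {ffun cube n -> bool}.

Definition chi (R : realType) (n : nat) (S : {set 'I_n}) (x : cube n) : R :=
  \prod_(i in S) pm1 R (x i).

Definition fourier_coef (R : realType) (n : nat) (f : boolean_function n)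
    (S : {set 'I_n}) : R :=
  (2 ^+ n)^-1 * \sum_(x : cube n) pm1 R (f x) * chi R S x.

Definition log2 (R : realType) (x : R) : R := ln x / ln 2.

(* [ln] and division are total, so a term with zero Fourier coefficient is a
   product with 0 and vanishes, as the usual convention demands. *)
Definition fourier_entropy (R : realType) (n : nat) (f : boolean_function n) : R :=
  \sum_(S : {set 'I_n})
    fourier_coef R f S ^+ 2 * log2 (1 / fourier_coef R f S ^+ 2).

Definition total_influence (R : realType) (n : nat) (f : boolean_function n) : R :=
  \sum_(S : {set 'I_n}) fourier_coef R f S ^+ 2 * #|S|%:R.

Definition counting_prob (R : realType) (T : finType) (P : pred T) : R :=
  #|P|%:R / #|T|%:R.

(* Main.v *)
(** The Fourier weights [f^(S)^2] form a probability distribution on [2^n]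
    points, so the entropy never exceeds [n]. It remains to see that the total
    influence [I] is close to [n / 2]. Writing [Z = n - 2 I], we have
    [Z = 4^-n \sum_(x, y) f(x) f(y) K(x, y)] with
    [K(x, y) = \sum_S (n - 2 |S|) chi_S(x) chi_S(y)], a symmetric kernel which
    vanishes on the diagonal. Such a Rademacher chaos has second moment
    [2 * 4^-2n * \sum_(x, y) K(x, y)^2 <= 2 n^2 / 2^n], and Chebyshev's
    inequality concludes. *)
Require Import Defs.
From HB Require Import structures.
From mathcomp Require Import all_boot all_order all_algebra.
From mathcomp Require Import all_classical all_reals all_analysis.
From mathcomp Require Import ring lra.

Set Implicit Arguments.
Unset Strict Implicit.
Unset Printing Implicit Defensive.

Import Order.TTheory GRing.Theory Num.Theory.
Import numFieldNormedType.Exports.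

Local Open Scope classical_set_scope.
Local Open Scope ring_scope.

(** * Moments of a Rademacher chaos, by sign flips *)

Lemma pm1_sqr (R : realType) (b : bool) : pm1 R b * pm1 R b = 1.
Proof. by rewrite /pm1 -expr2 sqrr_sign. Qed.

Lemma pm1N (R : realType) (b : bool) : pm1 R (~~ b) = - pm1 R b.
Proof. by rewrite /pm1 signrN. Qed.

Definition flip (T : finType) (u : T) (f : {ffun T -> bool}) :
  {ffun T -> bool} := [ffun v => if v == u then ~~ f v else f v].

Lemma flipK (T : finType) (u : T) : involutive (flip u).
Proof. by move=> f; apply/ffunP => v; rewrite !ffunE; case: eqP => // _; rewrite negbK. Qed.

Lemma pm1_flip (R : realType) (T : finType) (u v : T) (f : {ffun T -> bool}) :
  pm1 R (flip u f v) = (if v == u then -1 else 1) * pm1 R (f v).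
Proof. by rewrite ffunE; case: eqP => _; rewrite ?pm1N ?mulN1r ?mul1r. Qed.

(** Reindexing by the involution [flip u] shows that the sum equals its own opposite. This kills
    every moment in which some sign occurs an odd number of times. *)
Lemma sum_flip_odd (R : realType) (T : finType) (u : T)
    (F : {ffun T -> bool} -> R) :
  (forall f, F (flip u f) = - F f) -> \sum_f F f = 0.
Proof.
move=> FN; have /eqP : \sum_f F f = - \sum_f F f.
  rewrite {1}(reindex_inj (inv_inj (flipK u))) -sumrN.
  by apply: eq_bigr => f _; rewrite FN.
by rewrite -addr_eq0 -mulr2n mulrn_eq0 /= => /eqP.
Qed.

(** Unless the pairs agree up to order, [x] or [y] occurs exactly once among the four points, and
    flipping there makes the summand odd. Otherwise the signs square away. As [x != y], at most one
    of the two indicators is 1. *)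
Lemma rademacher_moment4 (R : realType) (T : finType) (x y z w : T) :
  x != y -> z != w ->
  \sum_(f : {ffun T -> bool})
    pm1 R (f x) * pm1 R (f y) * (pm1 R (f z) * pm1 R (f w)) =
  #|{ffun T -> bool}|%:R *
    (((z, w) == (x, y))%:R + ((z, w) == (y, x))%:R).
Proof.
move=> xy zw.
have yx : y != x by rewrite eq_sym.
have [xz|xz] := eqVneq z x; last have [xw|xw] := eqVneq w x.
- subst z; rewrite !xpair_eqE eqxx (negbTE xy) /= addr0.
  have [->|wy] := eqVneq w y.
    rewrite mulr1 -sumr_const; apply: eq_bigr => f _.
    by rewrite mulrACA !pm1_sqr mulr1.
  rewrite mulr0; apply: (@sum_flip_odd _ _ y) => f.
  by rewrite !pm1_flip (negbTE xy) eqxx (negbTE wy); ring.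
- subst w; rewrite !xpair_eqE eqxx (negbTE xy) (negbTE xz) /= add0r andbT.
  have [->|zy] := eqVneq z y.
    rewrite mulr1 -sumr_const; apply: eq_bigr => f _.
    by rewrite [X in _ * X]mulrC mulrACA !pm1_sqr mulr1.
  rewrite mulr0; apply: (@sum_flip_odd _ _ y) => f.
  by rewrite !pm1_flip (negbTE xy) eqxx (negbTE zy); ring.
- rewrite !xpair_eqE (negbTE xz) (negbTE xw) andbF addr0 mulr0.
  apply: (@sum_flip_odd _ _ x) => f.
  by rewrite !pm1_flip (negbTE xz) (negbTE xw) (negbTE yx) eqxx; ring.
Qed.

(** After expanding the square, the zero diagonal leaves only pairs covered by [rademacher_moment4].
    Each pair then meets itself and its transpose, which by symmetry contribute equally: hence the
    factor 2. *)
Lemma rademacher_chaos_moment2 (R : realType) (T : finType) (K : T * T -> R) :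
  (forall x, K (x, x) = 0) -> (forall x y, K (x, y) = K (y, x)) ->
  \sum_(f : {ffun T -> bool})
    (\sum_p pm1 R (f p.1) * pm1 R (f p.2) * K p) ^+ 2 =
  #|{ffun T -> bool}|%:R * (2 * \sum_p K p ^+ 2).
Proof.
move=> K0 Ksym.
under eq_bigr do rewrite expr2 big_distrlr /=.
rewrite exchange_big !mulr_sumr /=; apply: eq_bigr => -[x y] _ /=.
rewrite exchange_big /=.
have [->|xy] := eqVneq x y.
  rewrite K0 expr0n /= !mulr0 big1// => q _.
  by rewrite big1// => f _; rewrite mulr0 mul0r.
transitivity (\sum_q K (x, y) * K q * #|{ffun T -> bool}|%:R *
    ((q == (x, y))%:R + (q == (y, x))%:R)).
  apply: eq_bigr => -[z w] _ /=; have [->|zw] := eqVneq z w.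
    by rewrite K0 !(mulr0, mul0r) big1// => f _; rewrite !mulr0.
  rewrite -[RHS]mulrA -(rademacher_moment4 R xy zw) mulr_sumr.
  by apply: eq_bigr => f _; ring.
have pick (G : T * T -> R) p : \sum_q G q * (q == p)%:R = G p.
  rewrite (bigD1 p)//= eqxx mulr1 big1 ?addr0// => q /negbTE ->.
  by rewrite mulr0.
under eq_bigr do rewrite mulrDr.
by rewrite big_split /= !pick [K (y, x)]Ksym; ring.
Qed.

(** * Characters, Parseval and the entropy bound *)

Lemma card_cube (n : nat) : #|cube n| = (2 ^ n)%N.
Proof. by rewrite card_ffun card_bool card_ord. Qed.

Lemma card_subsets (n : nat) : #|{set 'I_n}| = (2 ^ n)%N.
Proof. by rewrite -cardsT -powersetT card_powerset cardsT card_ord. Qed.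

Lemma chi_sqr (R : realType) (n : nat) (S : {set 'I_n}) (x : cube n) :
  chi R S x * chi R S x = 1.
Proof. by rewrite /chi -big_split big1//= => i _; exact: pm1_sqr. Qed.

Lemma chi_flip (R : realType) (n : nat) (S : {set 'I_n}) (i : 'I_n)
    (x : cube n) :
  chi R S (flip i x) = (if i \in S then -1 else 1) * chi R S x.
Proof.
rewrite /chi; under eq_bigr do rewrite pm1_flip.
rewrite big_split /=; congr (_ * _); case: ifPn => iS.
  rewrite (bigD1 i)//= eqxx big1 ?mulr1// => j /andP[_ /negbTE ->] //.
by rewrite big1// => j jS; case: eqP => // ji; rewrite -ji jS in iS.
Qed.

Lemma chi_orthogonal (R : realType) (n : nat) (S U : {set 'I_n}) :
  \sum_x chi R S x * chi R U x = 2 ^+ n * (S == U)%:R.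
Proof.
have [<-|SU] := eqVneq S U.
  by under eq_bigr do rewrite chi_sqr; rewrite sumr_const card_cube natrX mulr1.
have [i iSU] : exists i, (i \in S) != (i \in U).
  apply/existsP; apply: contraNT SU; rewrite negb_exists => /forallP SU.
  by apply/eqP/setP => i; have := SU i; rewrite negbK => /eqP.
rewrite mulr0; apply: (@sum_flip_odd _ _ i) => x.
by rewrite !chi_flip; move: iSU; case: (i \in S); case: (i \in U) => // _; ring.
Qed.

Lemma chi_dual_orthogonal (R : realType) (n : nat) (x y : cube n) :
  \sum_S chi R S x * chi R S y = 2 ^+ n * (x == y)%:R.
Proof.
have [<-|xy] := eqVneq x y.
  by under eq_bigr do rewrite chi_sqr; rewrite sumr_const card_subsets natrX mulr1.
(* The sum over subsets factors over coordinates, and a coordinate where [x] and [y] differ gives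
   the factor -1 + 1. *)
transitivity (\prod_(i < n) (pm1 R (x i) * pm1 R (y i) + 1)).
  rewrite bigA_distr; apply: eq_bigr => S _.
  by rewrite /chi -big_split /= big_mkcond.
have [i xyi] : exists i, x i != y i.
  apply/existsP; apply: contraNT xy; rewrite negb_exists => /forallP xy.
  by apply/eqP/ffunP => i; have := xy i; rewrite negbK => /eqP.
rewrite mulr0 (bigD1 i)//=.
have -> : x i = ~~ y i by move: xyi; case: (x i); case: (y i).
by rewrite pm1N mulNr pm1_sqr addNr mul0r.
Qed.

(** Weighted sums of squared coefficients as quadratic forms in the values of [f]: constant weight 1
    yields Parseval, weight n - 2|S| the influence deviation. *)
Lemma sum_fourier_sqr (R : realType) (n : nat) (f : boolean_function n)
    (c : {set 'I_n} -> R) :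
  \sum_S fourier_coef R f S ^+ 2 * c S =
  (2 ^+ n) ^- 2 * \sum_p pm1 R (f p.1) * pm1 R (f p.2) *
    (\sum_S c S * (chi R S p.1 * chi R S p.2)).
Proof.
under [in RHS]eq_bigr do rewrite mulr_sumr.
rewrite exchange_big mulr_sumr; apply: eq_bigr => S _.
rewrite /fourier_coef exprMn exprVn -mulrA; congr (_ * _).
rewrite expr2 big_distrlr /= pair_big /= mulr_suml.
by apply: eq_bigr => p _; ring.
Qed.

Lemma parseval (R : realType) (n : nat) (f : boolean_function n) :
  \sum_S fourier_coef R f S ^+ 2 = 1.
Proof.
transitivity (\sum_S fourier_coef R f S ^+ 2 * 1).
  by apply: eq_bigr => S _; rewrite mulr1.
have dual (x y : cube n) : \sum_S 1 * (chi R S x * chi R S y) = 2 ^+ n * (x == y)%:R.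
  by rewrite -chi_dual_orthogonal; apply: eq_bigr => S _; rewrite mul1r.
rewrite (sum_fourier_sqr f (fun=> 1)) -(pair_bigA _ (fun x y =>
  pm1 R (f x) * pm1 R (f y) * (\sum_S 1 * (chi R S x * chi R S y)))) /=.
rewrite (eq_bigr (fun=> 2 ^+ n)) => [|x _].
  have n0 : (2 : R) ^+ n != 0 by rewrite expf_neq0.
  by rewrite sumr_const card_cube -[_ *+ (2 ^ n)%N]mulr_natr natrX; field.
rewrite (bigD1 x)//= [X in _ + X]big1 => [|y yx].
  by rewrite dual eqxx pm1_sqr addr0 mul1r mulr1.
by rewrite dual eq_sym (negbTE yx) !mulr0.
Qed.

(** Gibbs' inequality against the uniform distribution: apply ln t <= t - 1 at t = 1 / (w 2^n) for
    each weight w. The errors 2^-n - w sum to 0 by Parseval. *)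
Lemma fourier_entropy_le (R : realType) (n : nat) (f : boolean_function n) :
  fourier_entropy R f <= n%:R.
Proof.
have l2 : 0 < ln (2 : R) by rewrite ln_gt0// ltr1n.
have N0 : 0 < (2 : R) ^+ n by rewrite exprn_gt0.
rewrite /fourier_entropy /log2 -(ler_pM2r l2) mulr_suml.
set w := fun S => fourier_coef R f S ^+ 2.
apply: (@le_trans _ _ (\sum_S (w S * ln (2 ^+ n) + ((2 ^+ n)^-1 - w S)))).
  apply: ler_sum => S _; rewrite -/(w S) mulrA divfK ?gt_eqF//.
  (* A zero weight contributes 0 on the left and 2^-n on the right. *)
  have [->|wS0] := eqVneq (w S) 0.
    by rewrite !mul0r add0r subr0 invr_ge0 ltW.
  have w0 : 0 < w S by rewrite lt_def wS0 sqr_ge0.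
  have wN0 : 0 < w S * 2 ^+ n by exact: mulr_gt0.
  have : ln ((w S * 2 ^+ n)^-1) <= (w S * 2 ^+ n)^-1 - 1.
    have := @le_ln1Dx R ((w S * 2 ^+ n)^-1 - 1).
    rewrite addrCA subrr addr0; apply.
    by rewrite ltrBrDl subrr invr_gt0.
  rewrite lnV ?posrE// lnM ?posrE// => /(ler_wpM2l (ltW w0)).
  rewrite div1r lnV ?posrE//.
  have -> : w S * ((w S * 2 ^+ n)^-1 - 1) = (2 ^+ n)^-1 - w S.
    by field; rewrite wS0 gt_eqF.
  lra.
rewrite big_split /= -mulr_suml parseval mul1r sumrB parseval sumr_const.
rewrite card_subsets -[_ *+ (2 ^ n)%N]mulr_natr natrX mulVf ?gt_eqF// subrr addr0.
by rewrite lnXn// mulr_natl.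
Qed.

(** * Second moment of the influence deviation *)

Definition influence_kernel (R : realType) (n : nat) (p : cube n * cube n) : R :=
  \sum_(S : {set 'I_n}) (n%:R - 2 * #|S|%:R) * (chi R S p.1 * chi R S p.2).

Lemma influence_deviationE (R : realType) (n : nat) (f : boolean_function n) :
  n%:R - 2 * total_influence R f = (2 ^+ n) ^- 2 *
    \sum_p pm1 R (f p.1) * pm1 R (f p.2) * influence_kernel R p.
Proof.
rewrite -(sum_fourier_sqr f (fun S => n%:R - 2 * #|S|%:R)).
have nE : \sum_S fourier_coef R f S ^+ 2 * n%:R = n%:R.
  by rewrite -mulr_suml parseval mul1r.
rewrite -[X in X - _ = _]nE mulr_sumr -sumrB.
by apply: eq_bigr => S _; ring.
Qed.

Lemma influence_kernel_diag (R : realType) (n : nat) (x : cube n) :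
  influence_kernel R (x, x) = 0.
Proof.
rewrite /influence_kernel /=; under eq_bigr do rewrite chi_sqr mulr1.
(* Complementing S changes the sign of n - 2|S|. *)
set s := (X in X = _); have /eqP : s = - s.
  rewrite {1}/s (reindex_inj (inv_inj (@finset.setCK _))) -sumrN.
  apply: eq_bigr => S _; have := cardsC S; rewrite card_ord => nE.
  have -> : n%:R = #|S|%:R + #|(~: S)%SET|%:R :> R by rewrite -natrD nE.
  by ring.
by rewrite -addr_eq0 -mulr2n mulrn_eq0 /= => /eqP.
Qed.

(** The characters diagonalise the kernel, so by orthogonality the sum is 4^n times the sum of (n -
    2|S|)^2. Each of these 2^n squares is at most n^2. *)
Lemma sum_influence_kernel_sqr (R : realType) (n : nat) :
  \sum_(p : cube n * cube n) influence_kernel R p ^+ 2 <=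
  (2 ^+ n) ^+ 3 * n%:R ^+ 2.
Proof.

have -> : \sum_(p : cube n * cube n) influence_kernel R p ^+ 2 =
    \sum_(S : {set 'I_n}) (2 ^+ n) ^+ 2 * (n%:R - 2 * #|S|%:R) ^+ 2.
  under eq_bigr do rewrite expr2 big_distrlr /=.
  rewrite exchange_big; apply: eq_bigr => S _ /=; rewrite exchange_big /=.
  transitivity (\sum_(U : {set 'I_n}) (n%:R - 2 * #|S|%:R) * (n%:R - 2 * #|U|%:R) *
      (2 ^+ n * (S == U)%:R) ^+ 2 : R).
    apply: eq_bigr => U _; rewrite -chi_orthogonal [_ ^+ 2]expr2 big_distrlr /=.
    by rewrite pair_big /= mulr_sumr; apply: eq_bigr => p _; ring.
  rewrite (bigD1 S)//= big1 => [|U /negbTE US]; first by rewrite eqxx mulr1; ring.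
  by rewrite eq_sym US mulr0 expr0n mulr0.
rewrite -mulr_sumr [_ ^+ 3]exprSr -mulrA ler_wpM2l ?exprn_ge0//.
apply: (@le_trans _ _ (\sum_(S : {set 'I_n}) n%:R ^+ 2)).
  apply: ler_sum => S _; rewrite -[leLHS]real_normK ?num_real// lerXn2r ?nnegrE//.
  have Sn : #|S|%:R <= n%:R :> R by rewrite ler_nat -[leqRHS]card_ord max_card.
  have S0 : 0 <= #|S|%:R :> R by [].
  by rewrite ler_norml; apply/andP; split; lra.
by rewrite sumr_const card_subsets -[_ *+ (2 ^ n)%N]mulr_natl natrX.
Qed.

Lemma influence_deviation_moment2 (R : realType) (n : nat) :
  \sum_(f : boolean_function n) (n%:R - 2 * total_influence R f) ^+ 2 <=
  #|boolean_function n|%:R * (2 * n%:R ^+ 2 / 2 ^+ n).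
Proof.
have N0 : 0 < (2 : R) ^+ n by rewrite exprn_gt0.
under eq_bigr do rewrite influence_deviationE exprMn.
rewrite -mulr_sumr rademacher_chaos_moment2; first last.
- by move=> x y; apply: eq_bigr => S _; rewrite /= [chi R S x * _]mulrC.
- exact: influence_kernel_diag.
rewrite mulrCA ler_wpM2l// mulrCA -mulrA ler_wpM2l//.
(* The powers of 2^n combine as -4 + 3 = -1. *)
apply: (@le_trans _ _ (((2 ^+ n) ^- 2) ^+ 2 * ((2 ^+ n) ^+ 3 * n%:R ^+ 2))).
  by rewrite ler_wpM2l ?sqr_ge0 ?sum_influence_kernel_sqr.
by rewrite le_eqVlt; apply/orP; left; apply/eqP; field; rewrite gt_eqF.
Qed.

(** * Chebyshev's inequality and the limit *)

Lemma counting_prob_chebyshev (R : realType) (T : finType) (P : pred T)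
    (Z : T -> R) (a : R) :
  (forall t, ~~ P t -> a <= Z t ^+ 2) ->
  (#|T|%:R - #|P|%:R) * a <= \sum_t Z t ^+ 2.
Proof.
move=> Pa; have -> : #|T|%:R - #|P|%:R = #|predC P|%:R :> R.
  by rewrite -(cardC P) natrD addrC addKr.
rewrite mulr_natl -sumr_const [leRHS](bigID (mem (predC P))) /=.
apply: ler_wpDr; first by apply: sumr_ge0 => t _; exact: sqr_ge0.
by apply: ler_sum => t; exact: Pa.
Qed.

Lemma entropy_influence_prob_ge (R : realType) (delta : R) (n : nat) :
  0 < delta -> (0 < n)%N ->
  1 - 2 * ((2 + delta) / delta) ^+ 2 * 2^-1 ^+ n <=
  counting_prob R (fun f : boolean_function n =>
    fourier_entropy R f <= (2 + delta) * total_influence R f).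
Proof.
move=> d0 n0.
set P : pred (boolean_function n) := fun f => _.
have n0R : 0 < n%:R :> R by rewrite ltr0n.
have N0 : 0 < (2 : R) ^+ n by rewrite exprn_gt0.
have T0 : 0 < #|boolean_function n|%:R :> R.
  by rewrite ltr0n card_ffun card_bool expn_gt0.
have e0 : 0 < delta / (2 + delta) * n%:R by rewrite mulr_gt0// divr_gt0// addr_gt0.
have /counting_prob_chebyshev : forall f, ~~ P f ->
    (delta / (2 + delta) * n%:R) ^+ 2 <= (n%:R - 2 * total_influence R f) ^+ 2.
  move=> f; rewrite /P -ltNge => /lt_le_trans/(_ (fourier_entropy_le R f)) lt_n.
  (* Failure of the inequality gives (2 + delta) I < n, so n - 2 I exceeds n - 2 n / (2 + delta). *)
  have dev : delta / (2 + delta) * n%:R <= n%:R - 2 * total_influence R f.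
    by rewrite mulrAC ler_pdivrMr ?addr_gt0//; lra.
  by apply: lerXn2r => //; rewrite nnegrE ltW// (lt_le_trans e0).
move=> /le_trans/(_ (influence_deviation_moment2 R n)) cheb.
rewrite /counting_prob ler_pdivlMr// mulrBl mul1r lerBlDr -lerBlDl.
(* Threshold and moment bound both scale as n^2, so the failure probability is of order 2^-n. *)
rewrite -(ler_pM2r (exprn_gt0 2 e0)); apply: (le_trans cheb).
rewrite le_eqVlt exprVn; apply/orP; left; apply/eqP; field.
by rewrite !gt_eqF// addr_gt0.
Qed.

Theorem theorem1 (R : realType) (delta : R) (delta_gt0 : 0 < delta) :
  (fun n : nat =>
     counting_prob R (fun f : boolean_function n =>
       fourier_entropy R f <= (2 + delta) * total_influence R f))
    @ \oo --> (1 : R).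
Proof.
apply: (@squeeze_cvgr _ _ _ _
  (fun n => 1 - 2 * ((2 + delta) / delta) ^+ 2 * 2^-1 ^+ n) (fun=> 1)).
(* The lower bound is available for positive n only, hence eventually; the upper bound is that a
   probability is at most 1. *)
- near=> n; rewrite entropy_influence_prob_ge//=; last by near: n; exists 1%N.
  rewrite /counting_prob ler_pdivrMr ?mul1r ?ler_nat ?max_card//.
  by rewrite ltr0n card_ffun card_bool expn_gt0.
- rewrite -[X in _ --> X]subr0; apply: cvgB; first exact: cvg_cst.
  rewrite -[X in _ --> X](mulr0 (2 * ((2 + delta) / delta) ^+ 2)).
  apply: cvgM; first exact: cvg_cst.
  by apply: cvg_expr; rewrite ger0_norm ?invr_ge0// invf_lt1// ltr1n.
- exact: cvg_cst.
Unshelve. all: by end_near.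
Qed.
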